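(* In the bounded forecasting game with quadratic hedge (BFQH) with parameter $C>0$, Skeptic can force the event $$\sum_n v_n<\infty\iff \sum_n(x_n-m_n)\ \text{converges}.$$
   Context: Bounded forecasting game with quadratic hedge (BFQH), parameter $C>0$: $\mathcal K_0=1$. For $n=1,2,\ldots$: Forecaster announces $m_n\in[-C,C]$ and $v_n\in[0,C^2-m_n^2]$; Skeptic announces $M_n\in\mathbb R$ and $V_n\in\mathbb R$; Reality announces $x_n\in[-C,C]$; and $\mathcal K_n:=\mathcal K_{n-1}+M_n(x_n-m_n)+V_n((x_n-m_n)^2-v_n)$. All moves are public. A path is an infinite sequence $\xi=(m_1,v_1,x_1,m_2,v_2,x_2,\ldots)$ of allowed moves of Forecaster and Reality; $\Xi$ is the set of paths; an event is any subset of $\Xi$. A strategy $\mathcal P$ of Skeptic specifies his allowed move $(M_n,V_n)$ at each round $n$ as a function of $m_1,v_1,x_1,\ldots,m_{n-1},v_{n-1},x_{n-1},m_n,v_n$. Its capital process is $\mathcal K^{\mathcal P}_0=0$, $\mathcal K^{\mathcal P}_n=\mathcal K^{\mathcal P}_{n-1}+M_n(x_n-m_n)+V_n((x_n-m_n)^2-v_n)$ with $(M_n,V_n)$ given by $\mathcal P$. Skeptic can force an event $E$ if there is a strategy $\mathcal P$ such that $\mathcal K^{\mathcal P}_n(\xi)\ge-1$ for all $\xi\in\Xi$, $n\ge0$, and $\limsup_n\mathcal K^{\mathcal P}_n(\xi)=\infty$ for every $\xi\notin E$. For events, $E_1\Rightarrow E_2$ denotes $E_1^c\cup E_2$, and $E_1\Leftrightarrow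 E_2$ denotes $(E_1\cap E_2)\cup(E_1^c\cap E_2^c)$. ''Converges'' means converges to a finite real limit. *)

(* Defs.v *)
From mathcomp Require Import all_boot all_order all_algebra.
From mathcomp Require Import all_classical all_reals all_analysis.
Set Implicit Arguments.
Unset Strict Implicit.
Unset Printing Implicit Defensive.
Import Order.TTheory GRing.Theory Num.Theory.
Import numFieldNormedType.Exports.
Local Open Scope classical_set_scope.
Local Open Scope ring_scope.

(* The public moves of Forecaster ([mean], [var]) and of Reality
   ([outcome]) in one round. *)
Record round (R : Type) : Type := Round { mean : R; var : R; outcome : R }.

Definition allowed (R : realType) (C : R) (r : round R) : Prop :=
  [/\ - C <= mean r <= C, 0 <= var r <= C ^+ 2 - mean r ^+ 2
    & - C <= outcome r <= C].

(* Rounds are numbered from 0: round n of the game, n >= 1, has index n - 1. *)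
Record game_path (R : realType) (C : R) : Type := GamePath {
  moves :> nat -> round R;
  moves_allowed : forall n, allowed C (moves n) }.

Definition event (R : realType) (C : R) : Type := set (game_path C).

(* [P h m v] is the pair (M_n, V_n) announced after the completed rounds [h],
   in chronological order, once Forecaster has announced m_n = m and v_n = v.
   Only its values at allowed moves matter. *)
Definition strategy (R : realType) : Type := seq (round R) -> R -> R -> R * R.

Definition skeptic_move (R : realType) (P : strategy R)
    (xi : nat -> round R) (n : nat) : R * R :=
  P (mkseq xi n) (mean (xi n)) (var (xi n)).

Fixpoint capital (R : realType) (P : strategy R) (xi : nat -> round R)
    (n : nat) : R :=
  if n is k.+1 then
    let MV := skeptic_move P xi k in
    let d := outcome (xi k) - mean (xi k) in
    capital P xi k + MV.1 * d + MV.2 * (d ^+ 2 - var (xi k))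
  else 0.

Definition can_force (R : realType) (C : R) (E : event C) : Prop :=
  exists P : strategy R,
    (forall (xi : game_path C) (n : nat), - 1 <= capital P xi n) /\
    (forall xi : game_path C, ~ E xi ->
       limn_esup (fun n => (capital P xi n)%:E) = +oo%E).

Definition event_iff (R : realType) (C : R) (E1 E2 : event C) : event C :=
  (E1 `&` E2) `|` (~` E1 `&` ~` E2).

Definition var_summable (R : realType) (C : R) : event C :=
  [set xi : game_path C | (\sum_(0 <= n <oo) (var (xi n))%:E < +oo)%E].

Definition deviations_converge (R : realType) (C : R) : event C :=
  [set xi : game_path C |
    cvgn (series (fun n => outcome (xi n) - mean (xi n)))].

Arguments var_summable {R} C.
Arguments deviations_converge {R} C.

(* Main.v *)
Require Import Defs.
From mathcomp Require Import all_boot all_order all_algebra.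
From mathcomp Require Import all_classical all_reals all_analysis.
From mathcomp Require Import ring lra.
Import Order.TTheory GRing.Theory Num.Theory.
Import numFieldNormedType.Exports.
Local Open Scope ring_scope.

Set Implicit Arguments.
Unset Strict Implicit.
Unset Printing Implicit Defensive.

(** Write d_n = x_n - m_n, S_n = d_1 + ... + d_n and A_n = v_1 + ... + v_n.
The quadratic hedge lets Skeptic replicate S_n^2 - A_n: staking M = 2 S_{n-1}
on d_n and V = 1 on d_n^2 - v_n changes his capital by exactly
S_n^2 - S_{n-1}^2 - v_n.  Both implications come from this identity.

If the v_n are summable, the walk S converges.  Skeptic replicates
(D^2 - A) / L, where D is the increment of S since a moving anchor, reset to
the current value of S each time |D| reaches eps.  Each reset banks at least
eps^2 / L, while the hedge costs at most A / L in total; since v_n is announced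
before Skeptic moves, he can stop before A exceeds L and so never loses more
than 1.  If A stays below L, his capital is unbounded as soon as there are
infinitely many resets, and there are unless S eventually stays within 2 eps
of one of its values (can_force_small_oscillation).

If the walk S converges, the v_n are summable.  A convergent S is bounded, say
by L.  Skeptic replicates A - S^2, scaled by (L + 2C)^-2, and stops once
|S| > L; at that time |S| <= L + 2C because |d_n| <= 2C, so he never loses more
than 1.  If |S| never exceeds L, he is never stopped and his capital is
unbounded with A (can_force_bounded_var).

The levels L and eps are not known in advance.  A mixture over the index k,
with weights 2^-(k+1), handles all of them at once; its k-th component starts
playing at round k, so that each move is a finite sum
(can_force_bigcap_shift).  Starting late is harmless: summability and
convergence do not depend on the first rounds, and the relevant bounds survive
a shift up to a factor 2. *)

(** * Unbounded capital *)

(** This form of the winning condition avoids extended reals: an infinite upper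
limit of a real sequence means unboundedness above, as finitely many initial
terms cannot be responsible for the latter. *)
Lemma limn_esup_pinftyP (R : realType) (u : nat -> R) :
  limn_esup (fun n => (u n)%:E) = +oo%E <-> forall B, exists n, B < u n.
Proof.
split=> [uoo B | uoo].
  apply/not_existsP => uB; suff: (limn_esup (fun n => (u n)%:E) <= B%:E)%E.
    by rewrite uoo.
  apply: le_trans (ereal_inf_lbound _) _.
    by exists [set: nat]%classic => //; exact: filterT.
  apply: ge_ereal_sup => _ [n _ <-]; rewrite lee_fin leNgt; exact/negP/uB.
rewrite limn_esup_lim.
suff esups_oo n : esups (fun n => (u n)%:E) n = +oo%E.
  by rewrite (_ : esups _ = cst +oo%E) ?lim_cst //; apply/funext => n.
apply: eq_infty => B.
(* Exceeding the first n terms forces the witness k to be at least n. *)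
have [k Bk] := uoo (Num.max B (\big[Num.max/B]_(i < n) u i)).
move: Bk; rewrite gt_max => /andP[Bk uk].
have nk : (n <= k)%N.
  rewrite leqNgt; apply/negP => kn.
  by move: uk; rewrite ltNge (le_bigmax _ (fun i : 'I_n => u i) (Ordinal kn)).
apply: le_trans (ereal_sup_ubound _); last by exists k.
by rewrite lee_fin ltW.
Qed.

(** * Histories, deviations and totals along a path *)

Lemma drop_mkseq (T : Type) (f : nat -> T) k n :
  drop k (mkseq f n) = mkseq (fun i => f (k + i)%N) (n - k)%N.
Proof.
by rewrite /mkseq -map_drop drop_iota add0n -{1}[k]addn0 iotaDl -map_comp.
Qed.

Lemma foldl_mkseqS (S T : Type) (f : S -> T -> S) s0 (u : nat -> T) n :
  foldl f s0 (mkseq u n.+1) = f (foldl f s0 (mkseq u n)) (u n).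
Proof. by rewrite /mkseq -addn1 iotaD map_cat foldl_cat. Qed.

Definition deviation (R : realType) (r : round R) : R := outcome r - mean r.

Local Notation walk xi := (series (fun i => deviation (xi i))).
Local Notation total_var xi := (series (fun i => var (xi i))).

Section Paths.
Variables (R : realType) (C : R).
Implicit Types (xi : game_path C) (h : seq (round R)) (r : round R).

Definition shift k xi : game_path C :=
  GamePath (fun n => moves_allowed xi (k + n)%N).

Lemma series_shift (f : round R -> R) k xi n :
  series (fun i => f (shift k xi i)) n =
  series (fun i => f (xi i)) (k + n)%N - series (fun i => f (xi i)) k.
Proof.
elim: n => [|n IH]; first by rewrite addn0 subrr seriesEnat /= big_nil.
by rewrite addnS !seriesSr IH addrAC.
Qed.

Lemma var_ge0 xi n : 0 <= var (xi n).
Proof. by have [_ /andP[]] := moves_allowed xi n. Qed.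

Lemma var_series_ge0 xi n : 0 <= total_var xi n.
Proof. by apply: sumr_ge0 => i _; exact: var_ge0. Qed.

Lemma deviation_le xi n : `|deviation (xi n)| <= 2 * C.
Proof.
have [/andP[m1 m2] _ /andP[x1 x2]] := moves_allowed xi n.
by rewrite /deviation ler_norml; lra.
Qed.

Lemma var_summableP xi :
  var_summable C xi <-> exists B, forall n, total_var xi n <= B.
Proof.
have v0 n : (0 <= (var (xi n))%:E)%E by rewrite lee_fin var_ge0.
rewrite /var_summable /=; split=> [sv | [B vB]].
  have svfin : (\sum_(0 <= n <oo) (var (xi n))%:E)%E \is a fin_num.
    by rewrite ge0_fin_numE // nneseries_ge0.
  exists (fine (\sum_(0 <= n <oo) (var (xi n))%:E)%E) => n.
  rewrite -lee_fin fineK // /series /= -sumEFin.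
  exact: nneseries_lim_ge.
apply: (@le_lt_trans _ _ B%:E); last exact: ltry.
apply: lime_le; first by apply: is_cvg_nneseries => n _ _.
by apply: nearW => n; rewrite sumEFin lee_fin; exact: vB.
Qed.

Lemma can_force_sub (E F : event C) :
  (E `<=` F)%classic -> can_force E -> can_force F.
Proof.
by move=> EF [P [P1 PE]]; exists P; split=> // xi Fxi; apply: PE => /EF.
Qed.

(** * Mixing countably many strategies *)

(** Component k sees only the rounds from k on, so that at a history of length n
only the components 0, ..., n have started: no convergence of the stakes is at
issue. *)
Definition mixture (P : nat -> strategy R) : strategy R := fun h m v =>
  (\sum_(k < (size h).+1) 2 ^- k.+1 * (P k (drop k h) m v).1,
   \sum_(k < (size h).+1) 2 ^- k.+1 * (P k (drop k h) m v).2).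

(** Capital is linear in the moves, and component k has been playing for n - k
rounds; the component that starts at round n contributes its initial capital
0. *)
Lemma capital_mixture (P : nat -> strategy R) xi n :
  capital (mixture P) xi n =
  \sum_(k < n.+1) 2 ^- k.+1 * capital (P k) (shift k xi) (n - k)%N.
Proof.
elim: n => [|n IH]; first by rewrite big_ord1 /= mulr0.
rewrite big_ord_recr subnn /= mulr0 addr0 IH.
rewrite /skeptic_move /= size_mkseq 2!mulr_suml -2!big_split /=.
apply: eq_bigr => -[k kn] _ /=; rewrite subSn //= /skeptic_move /= subnKC //.
by rewrite drop_mkseq; ring.
Qed.

Lemma sum_weights n : \sum_(k < n) 2 ^- k.+1 = 1 - 2 ^- n :> R.
Proof.
elim: n => [|n IH]; first by rewrite big_ord0 expr0 invr1 subrr.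
rewrite big_ord_recr /= IH exprS invfM; lra.
Qed.

(** Each component loses at most its weight and the weights sum to at most 1, so
the mixture loses at most 1 and exceeds any bound with any one component. *)
Lemma can_force_bigcap_shift (E : nat -> event C) :
  (forall k, can_force (E k)) ->
  can_force [set xi | forall k, E k (shift k xi)]%classic.
Proof.
move=> /choice[P PE].
have term_ge0 xi n k :
    0 <= 2 ^- k.+1 * (1 + capital (P k) (shift k xi) (n - k)%N).
  have [P1 _] := PE k; have := P1 (shift k xi) (n - k)%N.
  by move=> ?; apply: mulr_ge0; [rewrite invr_ge0 exprn_ge0|lra].
have mix_ge xi n :
    \sum_(k < n.+1) 2 ^- k.+1 * (1 + capital (P k) (shift k xi) (n - k)%N) <=
    1 + capital (mixture P) xi n.
  under eq_bigr do rewrite mulrDr mulr1.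
  rewrite big_split /= sum_weights -capital_mixture lerD2r gerBl.
  by rewrite invr_ge0 exprn_ge0.
exists (mixture P); split=> [xi n | xi].
  by rewrite -subr_ge0 opprK addrC (le_trans _ (mix_ge xi n)) ?sumr_ge0.
move=> /existsNP[k /(proj2 (PE k)) /limn_esup_pinftyP Poo].
apply/limn_esup_pinftyP => B.
have [n Bn] := Poo (2 ^+ k.+1 * (1 + B) - 1).
exists (k + n)%N; rewrite -(ltrD2l 1); apply: lt_le_trans (mix_ge _ _).
have kn : (k < (k + n).+1)%N by rewrite ltnS leq_addr.
rewrite (bigD1 (Ordinal kn)) //= ltr_wpDr ?sumr_ge0 //.
  by move=> i _; exact: term_ge0.
by rewrite addKn ltr_pdivlMl ?exprn_gt0 //; lra.
Qed.

(** * Bounded total variance makes the walk oscillate little *)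

Section Oscillation.
Variables (L eps : R).
Hypotheses (L_gt0 : 0 < L) (eps_gt0 : 0 < eps).

(** The first component is the increment of the walk since the last reset, the
second one counts the resets. *)
Definition anchored_step (s : R * nat) r : R * nat :=
  let D := s.1 + deviation r in if `|D| < eps then (D, s.2) else (0, s.2.+1).

Definition anchored_state h : R * nat := foldl anchored_step (0, 0%N) h.

Definition oscillation_strategy : strategy R := fun h _ v =>
  if \sum_(r <- h) var r + v <= L
  then (L^-1 * (2 * (anchored_state h).1), L^-1) else (0, 0).

(** Replicating (D^2 - A) / L, each reset discards a D^2 that is at least eps^2.
The second conjunct records what has been banked; the first one has to be
carried along because the second says nothing once betting has stopped. *)
Lemma oscillation_capital_ge xi n :
  let s := anchored_state (mkseq xi n) in
  let A := total_var xi n in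
  - 1 <= capital oscillation_strategy xi n /\
  (A <= L -> L^-1 * (s.2%:R * eps ^+ 2 + s.1 ^+ 2 - A) <=
             capital oscillation_strategy xi n).
Proof.
elim: n => [|n [IH1 IH]].
  rewrite /= seriesEnat /= big_nil; split=> [|_]; first by lra.
  by rewrite mul0r expr0n /= addr0 subrr mulr0.
have Li : 0 < L^-1 by rewrite invr_gt0.
have LLi : L^-1 * L = 1 by rewrite mulVf ?gt_eqF.
have capS : capital oscillation_strategy xi n.+1 =
    let s := (anchored_state (mkseq xi n)).1 in
    let d := deviation (xi n) in
    let: (M, V) := if total_var xi n + var (xi n) <= L
      then (L^-1 * (2 * s), L^-1) else (0, 0) in
    capital oscillation_strategy xi n + M * d + V * (d ^+ 2 - var (xi n)).
  rewrite /= /skeptic_move {2 3}/oscillation_strategy big_map.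
  by rewrite seriesEnat /= /index_iota subn0; case: ifP.
rewrite {}capS /anchored_state foldl_mkseqS -/(anchored_state _).
rewrite seriesSr.
move: IH1 IH; set K := capital _ _ _; set s := anchored_state _.
set A := series _ n; set v := var (xi n).
set d := deviation _.
have v0 : 0 <= v := var_ge0 xi n.
move=> IH1 IH.
rewrite /=; case: ifPn => [AL | /negP AL /=]; last first.
  by rewrite !mul0r !addr0; split=> // ?; case: AL.
have {}IH : L^-1 * (s.2%:R * eps ^+ 2 + s.1 ^+ 2 - A) <= K by apply: IH; lra.
have main (N : nat) (D : R) :
    N%:R * eps ^+ 2 + D ^+ 2 <= s.2%:R * eps ^+ 2 + (s.1 + d) ^+ 2 ->
    L^-1 * (N%:R * eps ^+ 2 + D ^+ 2 - (A + v)) <=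
    K + L^-1 * (2 * s.1) * d + L^-1 * (d ^+ 2 - v).
  move=> ND.
  have -> : K + L^-1 * (2 * s.1) * d + L^-1 * (d ^+ 2 - v) =
    (K - L^-1 * (s.2%:R * eps ^+ 2 + s.1 ^+ 2 - A)) +
    L^-1 * (s.2%:R * eps ^+ 2 + (s.1 + d) ^+ 2 - (A + v)) by ring.
  by rewrite -[leLHS]add0r lerD ?subr_ge0 // ler_pM2l // lerD2r.
have {main}main : L^-1 * ((anchored_step s (xi n)).2%:R * eps ^+ 2 +
      (anchored_step s (xi n)).1 ^+ 2 - (A + v)) <=
    K + L^-1 * (2 * s.1) * d + L^-1 * (d ^+ 2 - v).
  apply: main; rewrite /anchored_step -/d; case: ltP => //= eps_le.
  rewrite expr0n /= addr0 -natr1 mulrDl mul1r lerD2l -[leRHS]real_normK ?num_real //.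
  by rewrite lerXn2r ?nnegrE // ltW.
split=> [|_ //]; apply: (le_trans _ main); rewrite -[X in - X]LLi -mulrN ler_pM2l //.
have : 0 <= (anchored_step s (xi n)).2%:R * eps ^+ 2 + (anchored_step s (xi n)).1 ^+ 2.
  by rewrite addr_ge0 ?sqr_ge0 // mulr_ge0 ?sqr_ge0 ?ler0n.
by move: AL; lra.
Qed.

(** Without a reset after time n0, the anchor is fixed and the walk stays within
eps of it, so no two later values differ by 2 eps. *)
Lemma resets_unbounded xi :
  (forall N, exists2 n, (N <= n)%N &
     2 * eps < `|walk xi n - walk xi N|) ->
  forall k, exists n, (k <= (anchored_state (mkseq xi n)).2)%N.
Proof.
move=> osc; set s := fun n => anchored_state (mkseq xi n).
have sS n : s n.+1 = anchored_step (s n) (xi n) by rewrite /s /anchored_state foldl_mkseqS.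
have sle n m : (n <= m)%N -> ((s n).2 <= (s m).2)%N.
  move=> /subnK <-; elim: (m - n)%N => [|p IH] //.
  by apply: leq_trans IH _; rewrite addSn sS /anchored_step; case: ifP => //= _.
elim=> [|k [n0 IH]]; first by exists 0%N.
have [n n0n] := osc n0.
apply: contraPP => noreset.
have {noreset}const m : (n0 <= m)%N -> (s m).2 = (s n0).2.
  move=> n0m; apply/eqP; rewrite eqn_leq (sle _ _ n0m) andbT.
  apply: leq_trans IH; rewrite leqNgt; apply/negP => km.
  by apply: noreset; exists m.
have small m : `|(s m).1| < eps.
  elim: m => [|m IHm]; first by rewrite /s /= normr0.
  by rewrite sS /anchored_step; case: ifP => //= _; rewrite normr0.
have track m : (s (n0 + m)%N).1 - (s n0).1 =
    walk xi (n0 + m)%N - walk xi n0.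
  elim: m => [|m IHm]; first by rewrite addn0 !subrr.
  have := const (n0 + m)%N (leq_addr _ _); have := const (n0 + m.+1)%N (leq_addr _ _).
  rewrite addnS seriesSr addrAC -IHm sS /anchored_step; case: ifP => [_ _ _|_ /= S1 S2].
    by rewrite /=; ring.
  by have := leqnn (s n0).2; rewrite -{1}S1 S2 ltnn.
apply/negP; rewrite -leNgt -(subnKC n0n) -track.
apply: le_trans (ler_normB _ _) _.
by have := small (n0 + (n - n0))%N; have := small n0; lra.
Qed.

Lemma can_force_small_oscillation :
  can_force [set xi : game_path C |
    (forall n, total_var xi n <= L) ->
    exists N, forall n, (N <= n)%N ->
      `|walk xi n - walk xi N| <= 2 * eps]%classic.
Proof.
exists oscillation_strategy; split=> [xi n | xi].
  by have [] := oscillation_capital_ge xi n.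
move=> /not_implyP[AL /forallNP osc]; apply/limn_esup_pinftyP => B.
have osc' N : exists2 n, (N <= n)%N &
     2 * eps < `|walk xi n - walk xi N|.
  have /existsNP[n /not_implyP[Nn /negP]] := osc N; rewrite -ltNge.
  by exists n.
have e2 : 0 < eps ^+ 2 by rewrite exprn_gt0.
(* More than k resets bank enough to pay for the hedge and still exceed B. *)
pose k := Num.truncn (L * (1 + `|B|) / eps ^+ 2).
have [n kn] := resets_unbounded osc' k.+1; exists n.
have [_ /(_ (AL n))] := oscillation_capital_ge xi n; apply: lt_le_trans.
rewrite ltr_pdivlMl //.
have : L * (1 + `|B|) < (anchored_state (mkseq xi n)).2%:R * eps ^+ 2.
  rewrite -ltr_pdivrMr // (lt_le_trans (truncnS_gt _)) //.
  by rewrite ler_nat.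
have : L * B <= L * `|B| by rewrite ler_pM2l // ler_norm.
have := sqr_ge0 (anchored_state (mkseq xi n)).1.
have := AL n; rewrite mulrDr mulr1; lra.
Qed.

End Oscillation.

(** * A bounded walk makes the total variance bounded *)

Section BoundedWalk.
Variable L : R.
Hypotheses (C_gt0 : 0 < C) (L_ge0 : 0 <= L).

(** The stopping time is encoded in the value itself: a value beyond L marks the
walk as stopped. *)
Definition stopped_walk h : R :=
  foldl (fun s r => if `|s| <= L then s + deviation r else s) 0 h.

(* The stopped walk overshoots L by at most 2C, so beta * S^2 <= 1. *)
Let beta : R := (L + 2 * C) ^- 2.

Definition variance_strategy : strategy R := fun h _ _ =>
  if `|stopped_walk h| <= L
  then (- (beta * (2 * stopped_walk h)), - beta) else (0, 0).

Let beta_gt0 : 0 < beta.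
Proof. by rewrite invr_gt0 exprn_gt0 // ltr_wpDl ?mulr_gt0. Qed.

Lemma stopped_walkS xi n : stopped_walk (mkseq xi n.+1) =
  let s := stopped_walk (mkseq xi n) in
  if `|s| <= L then s + deviation (xi n) else s.
Proof. by rewrite /stopped_walk foldl_mkseqS. Qed.

Lemma stopped_walk_le xi n : `|stopped_walk (mkseq xi n)| <= L + 2 * C.
Proof.
elim: n => [|n IH]; first by rewrite /= normr0 addr_ge0 // mulr_ge0 // ltW.
rewrite stopped_walkS /=; case: ifP => // sL.
by apply: le_trans (ler_normD _ _) _; rewrite lerD // deviation_le.
Qed.

Lemma beta_stopped_walk_le xi n : beta * stopped_walk (mkseq xi n) ^+ 2 <= 1.
Proof.
rewrite ler_pdivrMl ?mulr1; last by rewrite exprn_gt0 // ltr_wpDl ?mulr_gt0.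
rewrite -[leLHS]real_normK ?num_real // lerXn2r ?nnegrE //; last exact: stopped_walk_le.
by rewrite addr_ge0 // mulr_ge0 // ltW.
Qed.

(** The capital is beta * (A - S^2), both stopped, and A >= 0. *)
Lemma variance_capital_ge xi n :
  - (beta * stopped_walk (mkseq xi n) ^+ 2) <= capital variance_strategy xi n.
Proof.
elim: n => [|n IH]; first by rewrite /= expr0n /= mulr0 oppr0.
rewrite stopped_walkS /= /skeptic_move {2 3}/variance_strategy.
rewrite -/(deviation (xi n)).
have bv : 0 <= beta * var (xi n) by rewrite mulr_ge0 ?var_ge0 // ltW.
case: ifP => /= _; last by rewrite !mul0r !addr0.
rewrite -subr_ge0 in IH; rewrite -subr_ge0.
by have := addr_ge0 IH bv; congr (_ <= _); ring.
Qed.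

(** A walk that stays within L is never stopped. *)
Lemma variance_capitalE xi n :
  (forall k, `|walk xi k| <= L) ->
  stopped_walk (mkseq xi n) = walk xi n /\
  capital variance_strategy xi n =
  beta * (total_var xi n - stopped_walk (mkseq xi n) ^+ 2).
Proof.
move=> SL; elim: n => [|n [IHs IH]].
  by rewrite !seriesEnat /= !big_nil expr0n /= subrr mulr0.
have sL : `|stopped_walk (mkseq xi n)| <= L by rewrite IHs.
rewrite stopped_walkS !seriesSr /= -IHs /skeptic_move {2 3}/variance_strategy.
rewrite sL IH -/(deviation (xi n)) /=; split=> //; ring.
Qed.

Lemma can_force_bounded_var :
  can_force [set xi : game_path C |
    (forall n, `|walk xi n| <= L) ->
    exists B, forall n, total_var xi n <= B]%classic.
Proof.
exists variance_strategy; split=> [xi n | xi].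
  apply: le_trans (variance_capital_ge xi n).
  by rewrite lerN2 beta_stopped_walk_le.
move=> /not_implyP[SL /forallNP unb]; apply/limn_esup_pinftyP => B.
have /existsNP[n /negP] := unb (beta^-1 * (1 + B)); rewrite -ltNge => Bn.
exists n; have [_ ->] := variance_capitalE n SL.
have := beta_stopped_walk_le xi n.
by move: Bn; rewrite ltr_pdivrMl // mulrBr; lra.
Qed.

End BoundedWalk.

End Paths.

(** * Combining the two directions *)

Theorem theorem3p1 (R : realType) (C : R) (hC : 0 < C) :
  can_force (event_iff (var_summable C) (deviations_converge C)).
Proof.
(* Parity interleaves the two families of events. *)
pose E k := if odd k
  then [set xi : game_path C | (forall n, total_var xi n <= k.+1%:R) ->
    exists N, forall n, (N <= n)%N -> `|walk xi n - walk xi N| <= 2 * k.+1%:R^-1]%classic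
  else [set xi : game_path C | (forall n, `|walk xi n| <= k%:R) ->
    exists B, forall n, total_var xi n <= B]%classic.
have large (x : R) (b : bool) : exists2 k, odd k = b & x <= k%:R.
  exists (b + (Num.truncn x).+1.*2)%N; first by rewrite oddD odd_double addbF oddb.
  apply: le_trans (ltW (truncnS_gt x)) _; rewrite ler_nat.
  by rewrite -addnn addnA leq_addl.
apply: (@can_force_sub _ _ [set xi | forall k, E k (shift k xi)]%classic); last first.
  apply: can_force_bigcap_shift => k; rewrite /E; case: ifP => _.
    by apply: can_force_small_oscillation.
  by apply: can_force_bounded_var.
move=> xi Exi.
suff [VS SV] : (var_summable C xi -> deviations_converge C xi) /\
          (deviations_converge C xi -> var_summable C xi).
  have [Vxi|Vxi] := EM (var_summable C xi); first by left; split=> //; exact: VS.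
  by right; split=> // /SV.
split=> [/var_summableP[B AB] | Scvg]; last first.
  have [M [_ SM]] := cvg_seq_bounded Scvg.
  (* The walk restarted at k is a difference of two values, hence the factor 2. *)
  have [k ek kM] := large (2 * (M + 1)) false.
  have Sle n : `|walk xi n| <= M + 1 by apply: (SM (M + 1)) => //; lra.
  have := Exi k; rewrite /E ek => /(_ _)[n|B AB].
    rewrite series_shift; apply: le_trans (ler_normB _ _) _.
    by have := Sle k; have := Sle (k + n)%N; lra.
  apply/var_summableP; exists (total_var xi k + B) => n.
  have [nk|kn] := leqP n k.
    have B0 : 0 <= B by rewrite (le_trans _ (AB 0%N)) // var_series_ge0.
    apply: (@le_trans _ _ (total_var xi k)); last by rewrite lerDl.
    by rewrite -subr_ge0 -(subnKC nk) -(series_shift (@var R)) var_series_ge0.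
  by have := AB (n - k)%N; rewrite (series_shift (@var R)) subnKC ?lerBlDl ?(ltnW kn).
apply/cauchy_cvgP/cauchy_exP => e e0.
have [k ok kB] := large (Num.max B (2 / e)) true.
move: kB; rewrite ge_max => /andP[kB ke].
have k1 : k%:R <= k.+1%:R :> R by rewrite ler_nat.
have := Exi k; rewrite /E ok => /(_ _)[n|N SN].
  rewrite series_shift lerBlDr (le_trans (AB _)) // (le_trans kB) //.
  by rewrite (le_trans k1) // lerDl var_series_ge0.
exists (walk xi (k + N)%N); exists (k + N)%N => // n /= kNn.
have kn : (k <= n)%N by rewrite (leq_trans (leq_addr N k)).
have /SN : (N <= n - k)%N by rewrite leq_subRL.
rewrite !series_shift subnKC // opprB addrA subrK distrC => Sn.
apply: le_lt_trans Sn _; rewrite ltr_pdivrMr ?ltr0Sn //.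
by rewrite mulrC -ltr_pdivrMr // (le_lt_trans ke) // ltr_nat.
Qed.
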